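(* We have \[\sum_{k\ge0}|\mathcal U_{2k+1}(231,4132)|\,x^k=C(xC(x)),\] where $C(x)=\frac{1-\sqrt{1-4x}}{2x}$ is the generating function of the Catalan numbers.
   Context: The stack-sorting map $s$ on permutations (finite words of distinct positive integers): $s(\text{empty})=\text{empty}$, and if $\pi=LnR$ with $n$ the largest entry, $s(\pi)=s(L)s(R)n$. A permutation is uniquely sorted if it has exactly one preimage under $s$. A permutation avoids $\tau$ if no subsequence has the same relative order as $\tau$; $\mathcal U_n(\tau^{(1)},\tau^{(2)})$ is the set of uniquely sorted permutations of $[n]$ avoiding both patterns. *)

(* Defs.v *)
From HB Require Import structures.
From mathcomp Require Import all_boot all_order all_algebra.
From mathcomp Require Import ring.

Set Implicit Arguments.
Unset Strict Implicit.
Unset Printing Implicit Defensive.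

Import Order.TTheory GRing.Theory Num.Theory.

(* A permutation is a finite word of distinct positive integers. *)
Definition is_permutation (w : seq nat) : bool := uniq w && (0 \notin w).

Definition max_entry (w : seq nat) : nat := foldr maxn 0 w.

(* The first argument is fuel; size w is enough, see stack_sort_split. *)
Fixpoint stack_sort_rec (fuel : nat) (w : seq nat) : seq nat :=
  if fuel is m.+1 then
    if w is [::] then [::] else
    let i := index (max_entry w) w in
    stack_sort_rec m (take i w) ++ stack_sort_rec m (drop i.+1 w)
      ++ [:: max_entry w]
  else [::].

Definition stack_sort (w : seq nat) : seq nat := stack_sort_rec (size w) w.

(* Every preimage of w under stack_sort is a rearrangement of w, so it is
   enough to look among those; see uniquely_sortedP. *)
Definition uniquely_sorted (w : seq nat) : bool :=
  count (fun v => stack_sort v == w) (permutations w) == 1.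

Definition same_relative_order (u v : seq nat) : bool :=
  (size u == size v) &&
  [forall i : 'I_(size u), forall j : 'I_(size u),
     (nth 0 u i < nth 0 u j) == (nth 0 v i < nth 0 v j)].

Definition contains (w tau : seq nat) : bool :=
  [exists m : (size w).-tuple bool, same_relative_order (mask m w) tau].

Definition avoids (w tau : seq nat) : bool := ~~ contains w tau.

(* A duplicate-free enumeration: its size is the cardinality of the set. *)
Definition U (n : nat) (tau1 tau2 : seq nat) : seq (seq nat) :=
  [seq w <- permutations (iota 1 n) |
    [&& uniquely_sorted w, avoids w tau1 & avoids w tau2]].

Lemma max_entry_mem w : w != [::] -> max_entry w \in w.
Proof.
elim: w => // a w IH _ /=; rewrite inE.
case: (w =P [::]) => [->|/eqP/IH H]; first by rewrite /= maxn0 eqxx.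
by rewrite /maxn; case: ifP => _; rewrite ?eqxx // H orbT.
Qed.

Lemma leq_max_entry w x : x \in w -> x <= max_entry w.
Proof.
elim: w => //= a w IH; rewrite inE leq_max => /orP[/eqP->|/IH->];
  by rewrite ?leqnn ?orbT.
Qed.

Lemma stack_sort_rec_fuel m w :
  size w <= m -> stack_sort_rec m w = stack_sort w.
Proof.
rewrite /stack_sort.
have [k] := ubnP (size w); elim: k m w => // k IH [|m] [|a w] //= ltk lem.
have lti : index (max_entry (a :: w)) (a :: w) < (size w).+1.
  by rewrite -[(size w).+1]/(size (a :: w)) index_mem max_entry_mem.
rewrite -/(max_entry (a :: w)); set i := (if _ then 0 else _) in lti *.
set l := take i _; set r := drop i w.
have hl : size l <= size w.
  by rewrite size_take /= lti -ltnS.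
have hr : size r <= size w by rewrite size_drop leq_subr.
have fuel v m' : size v <= size w -> size w <= m' ->
    stack_sort_rec m' v = stack_sort_rec (size v) v.
  move=> hv hm; apply: IH; last exact: leq_trans hv hm.
  by rewrite ltnS in ltk; apply: leq_ltn_trans hv _.
by rewrite !fuel.
Qed.

Lemma stack_sort_nil : stack_sort [::] = [::].
Proof. by []. Qed.

Lemma stack_sort_split (L R : seq nat) (n : nat) :
  all (fun x => x < n) (L ++ R) ->
  stack_sort (L ++ n :: R) = stack_sort L ++ stack_sort R ++ [:: n].
Proof.
move=> lt_n.
have maxE : max_entry (L ++ n :: R) = n.
  apply/eqP; rewrite eqn_leq leq_max_entry ?mem_cat ?inE ?eqxx ?orbT // andbT.
  have : max_entry (L ++ n :: R) \in L ++ n :: R.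
    by apply: max_entry_mem; case: (L).
  rewrite mem_cat inE orbCA -mem_cat => /orP[/eqP->//|/(allP lt_n)].
  exact: ltnW.
have nL : n \notin L.
  apply/negP => nL; have := allP lt_n n; rewrite mem_cat nL ltnn.
  by move=> /(_ isT).
have idxE : index n (L ++ n :: R) = size L.
  by rewrite index_cat (negPf nL) /= eqxx addn0.
rewrite {1}/stack_sort size_cat /= addnS.
have -> k w : w != [::] -> stack_sort_rec k.+1 w =
   stack_sort_rec k (take (index (max_entry w) w) w) ++
   stack_sort_rec k (drop (index (max_entry w) w).+1 w) ++ [:: max_entry w].
  by case: w.
  rewrite maxE idxE take_size_cat // drop_cat ltnNge leqnSn /= subSnn /= drop0.
  by rewrite !stack_sort_rec_fuel ?leq_addr ?leq_addl.
by case: (L).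
Qed.

Lemma perm_stack_sort w : perm_eq (stack_sort w) w.
Proof.
have [m lem] : exists m, size w <= m by exists (size w).
rewrite -(stack_sort_rec_fuel lem).
elim: m w lem => [|m IH] [|a v] // lem.
have -> : stack_sort_rec m.+1 (a :: v) =
  let i := index (max_entry (a :: v)) (a :: v) in
  stack_sort_rec m (take i (a :: v)) ++ stack_sort_rec m (drop i.+1 (a :: v))
    ++ [:: max_entry (a :: v)] by [].
move: (a :: v) lem (@max_entry_mem (a :: v) isT) => w lem mem /=.
set i := index _ _.
have lti : i < size w by rewrite index_mem.
have wE : w = take i w ++ max_entry w :: drop i.+1 w.
  by rewrite -{1}(cat_take_drop i w) (drop_nth 0) // nth_index.
rewrite [X in perm_eq _ X]wE perm_cat //.
  by apply: IH; rewrite size_take lti -ltnS (leq_trans lti).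
rewrite perm_catC /= perm_cons; apply: IH.
by rewrite size_drop -ltnS (leq_trans _ lem) // ltn_subrL (leq_trans _ lti).
Qed.

Lemma uniquely_sortedP w : is_permutation w ->
  reflect (exists! v, is_permutation v /\ stack_sort v = w) (uniquely_sorted w).
Proof.
move=> /andP[uw w0].
have permE v : stack_sort v = w -> v \in permutations w.
  by move=> <-; rewrite mem_permutations perm_sym perm_stack_sort.
have isp v : v \in permutations w -> is_permutation v.
  rewrite mem_permutations => pv.
  by rewrite /is_permutation (perm_uniq pv) uw (perm_mem pv).
pose t := [seq v <- permutations w | stack_sort v == w].
have tE v : (v \in t) = (stack_sort v == w).
  by rewrite mem_filter andb_idr // => /eqP/permE.
have ut : uniq t by rewrite filter_uniq ?permutations_uniq.
rewrite /uniquely_sorted -size_filter -/t.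
apply: (iffP idP) => [/eqP st|[v [[_ /eqP vw] uniqv]]].
  move: tE; case: t st {ut} => [|v [|]] //= _ tE.
  have /esym/eqP vw := tE v; rewrite inE eqxx in vw.
  exists v; split=> [|v' [_ /eqP]]; last by rewrite -tE inE => /eqP.
  by split=> //; apply/isp/permE.
apply/eqP/(@perm_size _ t [:: v])/uniq_perm => // v'.
rewrite tE inE; apply/eqP/eqP => [v'w|->]; last exact/eqP.
by rewrite (uniqv v') //; split=> //; apply/isp/permE.
Qed.

Lemma containsP w tau :
  reflect (exists2 u, subseq u w & same_relative_order u tau) (contains w tau).
Proof.
apply: (iffP existsP) => [[m mP]|[u /subseqP[m sm ->] mP]].
  by exists (mask m w) => //; apply: mask_subseq.
by exists (tcast sm (in_tuple m)); rewrite val_tcast.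
Qed.

Lemma mem_U n tau1 tau2 w :
  (w \in U n tau1 tau2) = [&& perm_eq w (iota 1 n), uniquely_sorted w,
                              avoids w tau1 & avoids w tau2].
Proof. by rewrite mem_filter mem_permutations andbC. Qed.

Lemma U_uniq n tau1 tau2 : uniq (U n tau1 tau2).
Proof. by rewrite filter_uniq ?permutations_uniq. Qed.

Local Open Scope ring_scope.

(* Formal power series over the rationals, as coefficient sequences. *)
Definition fps : Type := nat -> rat.

Definition fps_one : fps := fun n => (n == 0)%N%:R.
Definition fps_X : fps := fun n => (n == 1)%N%:R.
Definition fps_sub (f g : fps) : fps := fun n => f n - g n.
Definition fps_scale (c : rat) (f : fps) : fps := fun n => c * f n.

Definition fps_mul (f g : fps) : fps :=
  fun n => \sum_(i < n.+1) f i * g (n - i)%N.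

Definition fps_exp (f : fps) (k : nat) : fps := iter k (fps_mul f) fps_one.

(* f(g(x)), meaningful when g 0 = 0: then g^k has no terms of degree < k. *)
Definition fps_comp (f g : fps) : fps :=
  fun n => \sum_(k < n.+1) f k * fps_exp g k n.

(* f(x) / x, meaningful when f 0 = 0. *)
Definition fps_divX (f : fps) : fps := fun n => f n.+1.

(* (1 + x)^a *)
Definition fps_binomial (a : rat) : fps :=
  fun k => (\prod_(i < k) (a - i%:R)) / k`!%:R.

(* The square root with constant term 1, meaningful when f 0 = 1. *)
Definition fps_sqrt (f : fps) : fps :=
  fps_comp (fps_binomial (1 / 2)) (fps_sub f fps_one).

(* C(x) = (1 - sqrt (1 - 4 x)) / (2 x) *)
Definition catalan_gf : fps :=
  fps_scale (1 / 2)
    (fps_divX (fps_sub fps_one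
                 (fps_sqrt (fps_sub fps_one (fps_scale 4 fps_X))))).

Lemma fps_sqrt_1B4X n :
  fps_sqrt (fps_sub fps_one (fps_scale 4 fps_X)) n
  = fps_binomial (1 / 2) n * (- 4) ^+ n.
Proof.
rewrite /fps_sqrt /fps_comp; set g := fps_sub _ _.
have gE m : g m = - 4 * (m == 1)%N%:R.
  by rewrite /g /fps_sub /fps_one /fps_scale /fps_X; ring.
have gX k : forall m, fps_exp g k m = (- 4) ^+ k * (m == k)%N%:R.
  elim: k => [|k IH] m; first by rewrite expr0 mul1r.
  rewrite /fps_exp iterS -/(fps_exp g k) /fps_mul.
  case: m => [|m]; first by rewrite big_ord1 gE !mulr0 mul0r.
  rewrite big_ord_recl gE mulr0 mul0r add0r big_ord_recl gE mulr1 big1.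
    by rewrite addr0 IH /bump /= subSS subn0 eqSS exprS mulrA.
  by move=> i _; rewrite gE /bump /= mulr0 mul0r.
rewrite big_ord_recr /= gX eqxx mulr1 big1 ?add0r // => i _.
by rewrite gX gtn_eqF // !mulr0.
Qed.

Lemma fps_sqrt_1B4X_rec (s := fps_sqrt (fps_sub fps_one (fps_scale 4 fps_X))) n :
  n.+1%:R * s n.+1 = (4 * n%:R - 2) * s n.
Proof.
have n0 : n.+1%:R != 0 :> rat by rewrite pnatr_eq0.
have f0 : n`!%:R != 0 :> rat by rewrite pnatr_eq0 -lt0n fact_gt0.
rewrite /s !fps_sqrt_1B4X /fps_binomial big_ord_recr /= factS natrM exprS.
by rewrite -natr1 in n0 *; field; rewrite f0 n0.
Qed.

Lemma fps_sqrt_1B4X_square (f := fps_sub fps_one (fps_scale 4 fps_X)) :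
  fps_mul (fps_sqrt f) (fps_sqrt f) =1 f.
Proof.
pose s := fps_sqrt f; pose t := fps_mul s s.
have s0 : s 0%N = 1.
  by rewrite /s fps_sqrt_1B4X /fps_binomial big_ord0 expr0 fact0.
have sS n : n.+1%:R * s n.+1 = (4 * n%:R - 2) * s n.
  exact: fps_sqrt_1B4X_rec.
have tD n : n%:R * t n = 2 * \sum_(i < n.+1) i%:R * (s i * s (n - i)%N).
  have rev : \sum_(i < n.+1) i%:R * (s i * s (n - i)%N)
           = \sum_(i < n.+1) (n - i)%:R * (s i * s (n - i)%N).
    rewrite (reindex_inj rev_ord_inj) /=; apply: eq_bigr => i _.
    by rewrite subSS subKn ?(mulrC (s i)) // -ltnS.
  rewrite [RHS]mulr_natl mulr2n {2}rev -big_split mulr_sumr; apply: eq_bigr => i _ /=.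
  by rewrite -mulrDl -natrD subnKC // -ltnS.
have tS n : n.+1%:R * t n.+1 = (4 * n%:R - 4) * t n.
  rewrite tD big_ord_recl mul0r add0r mulrBl -mulrA tD /t /fps_mul.
  rewrite !mulr_sumr -sumrB; apply: eq_bigr => i _.
  rewrite lift0 subSS (mulrA i.+1%:R) sS.
  by ring.
have t0 : t 0%N = 1 by rewrite /t /fps_mul big_ord1 s0 mulr1.
have t1 : t 1%N = - 4 by have := tS 0%N; rewrite t0 mul1r => ->.
have t2 n : t n.+2 = 0.
  have n0 k : k.+1%:R != 0 :> rat by rewrite pnatr_eq0.
  elim: n => [|n IH].
    by apply: (mulfI (n0 1%N)); rewrite tS mulr1 subrr mul0r mulr0.
  by apply: (mulfI (n0 n.+2)); rewrite tS IH !mulr0.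
move=> [|[|n]]; rewrite -/s -/t ?t0 ?t1 ?t2 //.
Qed.

Lemma catalan_gfE n : catalan_gf n = 'C(n.*2, n)%:R / n.+1%:R.
Proof.
pose s := fps_sqrt (fps_sub fps_one (fps_scale 4 fps_X)).
have sS m : m.+1%:R * s m.+1 = (4 * m%:R - 2) * s m.
  exact: fps_sqrt_1B4X_rec.
have cE m : catalan_gf m = 1 / 2 * - s m.+1.
  by rewrite /catalan_gf -/s /fps_scale /fps_divX /fps_sub /fps_one /= sub0r.
have cS m : m.+2%:R * catalan_gf m.+1 = (4 * m%:R + 2) * catalan_gf m.
  by rewrite !cE mulrCA mulrN sS -natr1; field.
have n0 k : k.+1%:R != 0 :> rat by rewrite pnatr_eq0.
have binS m : (m.+1 * 'C(m.+1.*2, m.+1) = 2 * m.*2.+1 * 'C(m.*2, m))%N.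
  have sym : 'C(m.*2.+1, m) = 'C(m.*2.+1, m.+1).
    rewrite -bin_sub ?leqW -?addnn ?leq_addr //.
    by rewrite -addnS addnC addnK.
  apply/eqP; rewrite -(eqn_pmul2l (ltn0Sn m)) -mul_bin_diag /= sym.
  by rewrite mulnCA -mul_bin_diag /= doubleS -doubleS -mul2n; apply/eqP; ring.
elim: n => [|n IH].
  have s0 : s 0%N = 1.
    by rewrite /s fps_sqrt_1B4X /fps_binomial big_ord0 expr0 fact0.
  by have := sS 0%N; rewrite s0 mul1r cE => ->.
apply: (mulfI (n0 n.+1)); rewrite cS IH.
have /(congr1 (fun k : nat => k%:R : rat)) := binS n.
rewrite !natrM -[n.*2.+1%:R]natr1 -[in n.*2%:R]mul2n natrM => H.
have -> : 'C(n.+1.*2, n.+1)%:R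
        = 2 * (2 * n%:R + 1) * 'C(n.*2, n)%:R / n.+1%:R :> rat.
  by rewrite -H mulrC mulKf.
have n1 := n0 n; have n2 := n0 n.+1; rewrite -!natr1 in n1 n2 *.
by field; rewrite n1 n2.
Qed.

(* Main.v *)
Require Import Defs.
From HB Require Import structures.
From mathcomp Require Import all_boot all_order all_algebra.
From mathcomp Require Import zify ring lra.

(* A preimage of w under stack_sort is the in-order reading of a decreasing
   binary tree with postorder reading w, so preimages correspond to the
   successful runs of a shift-reduce parser which, on reading a letter a, makes
   a the root of zero, one (left or right child) or two of the topmost trees,
   whose roots must be smaller than a.  A run that merges a single tree has a
   left-right twin, and a run that shifts a on top of a smaller root can be
   changed into one merging a single tree.  Hence w is uniquely sorted exactly
   when the greedy parser, which shifts at descents and merges two trees at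
   ascents, ends with one tree.
   A permutation avoiding 231 and 4132 is a direct sum of blocks, each a
   maximum followed by a decreasing and then an increasing word.  Inserting
   the values in increasing order encodes it by a word whose letters put the
   new value at the front or at the back of the current block, or close the
   block with its maximum.  On such words the greedy parser is governed by two
   counters.  With F = C(x C(x)), which satisfies F = 1 + x C F^2, the number
   of accepted continuations of each pair of counters is a coefficient of an
   explicit polynomial in C and F. *)

Set Implicit Arguments.
Unset Strict Implicit.
Unset Printing Implicit Defensive.

(** * Preimages as parser runs *)

(* A stack entry is a tree, given by its root and its in-order reading. *)
Fixpoint parses (st : seq (nat * seq nat)) (w : seq nat) : seq (seq nat) :=
  if w is a :: w' then
    parses ((a, [:: a]) :: st) w' ++
    (if st is p :: st1 then
       if p.1 < a then
         parses ((a, rcons p.2 a) :: st1) w' ++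
         parses ((a, a :: p.2) :: st1) w' ++
         (if st1 is q :: st2 then
            if q.1 < a then parses ((a, q.2 ++ a :: p.2) :: st2) w' else [::]
          else [::])
       else [::]
     else [::])
  else if st is [:: p] then [:: p.2] else [::].

Definition rooted (p : nat * seq nat) : bool := all (leq^~ p.1) p.2.

Lemma rooted_lt p a : rooted p -> p.1 < a -> all (fun x => x < a) p.2.
Proof. by move=> /allP rp lt_a; apply/allP => x /rp /leq_ltn_trans; apply. Qed.

(** Invariant of a run: the final tree sorts to the sorted trees of the stack, from bottom to top,
    followed by the unread input. A merge under [a] preserves it because [a] exceeds the merged
    roots, hence all letters of their trees. *)
Lemma parses_sound v st w : all rooted st -> v \in parses st w ->
  stack_sort v = flatten (rev [seq stack_sort p.2 | p <- st]) ++ w.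
Proof.
have sort_cons a x : all (fun x => x < a) x ->
    stack_sort (a :: x) = stack_sort x ++ [:: a].
  by move=> lt_a; rewrite -[a :: x]cat0s stack_sort_split.
have sort_rcons a x : all (fun x => x < a) x ->
    stack_sort (rcons x a) = stack_sort x ++ [:: a].
  by move=> lt_a; rewrite -cats1 stack_sort_split ?cats0.
have lt_le a (x : seq nat) : all (fun x => x < a) x -> all (leq^~ a) x.
  by apply: sub_all => y /ltnW.
elim: w st => [|a w IH] st rst /=.
  by case: st {rst} => [|p [|? ?]] //; rewrite inE => /eqP->; rewrite /= !cats0.
rewrite mem_cat => /orP[/IH->|].
- by rewrite /= rev_cons flatten_rcons -catA.
- by rewrite /= /rooted /= leqnn.
case: st rst => [|p st] //= /andP[rp rst]; case: ifP => // lt_p.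
have lt_a := rooted_lt rp lt_p.
rewrite !mem_cat => /orP[/IH->|/orP[/IH->|]].
- by rewrite /= !rev_cons !flatten_rcons sort_rcons // -!catA.
- by rewrite /= /rooted /= all_rcons leqnn lt_le.
- by rewrite /= !rev_cons !flatten_rcons sort_cons // -!catA.
- by rewrite /= /rooted /= leqnn lt_le.
case: st rst => [|q st] //= /andP[rq rst]; case: ifP => // lt_q /IH->.
  rewrite /= !rev_cons !flatten_rcons stack_sort_split -?catA //.
  by rewrite all_cat lt_a (rooted_lt rq).
by rewrite /= /rooted /= all_cat /= leqnn !lt_le // (rooted_lt rq).
Qed.

(** Induction on the tree. Writing v = L m R with m the maximum, the run reads the sorted word of L,
    then that of R, then m; the four cases of empty or nonempty L and R use the four moves of the
    parser. *)
Lemma parses_complete v st w : uniq v -> v != [::] ->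
  {subset parses ((max_entry v, v) :: st) w <= parses st (stack_sort v ++ w)}.
Proof.
have [k] := ubnP (size v); elim: k v st w => // k IH v st w ltk uv v0.
set m := max_entry v.
have [L [R vE]] : exists L R, v = L ++ m :: R.
  have /path.splitP[L R] := max_entry_mem v0.
  by exists L, R; rewrite cat_rcons.
have lt_m x : x \in L ++ R -> x < m.
  move=> xLR; rewrite ltn_neqAle leq_max_entry; last first.
    by move: xLR; rewrite vE !mem_cat inE => /orP[]->; rewrite ?orbT.
  rewrite andbT; apply: contraTneq uv => xm; rewrite vE -xm.
  by rewrite -cat1s uniq_catCA /= xLR.
rewrite [in stack_sort v]vE stack_sort_split; last exact/allP.
have [ltL ltR] : size L < k /\ size R < k.
  move: ltk; rewrite vE size_cat /=; lia.
have [uL uR] : uniq L /\ uniq R.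
  by move: uv; rewrite vE cat_uniq /= => /and3P[-> _ /andP[]].
have maxL : L != [::] -> max_entry L < m.
  by move=> L0; apply: lt_m; rewrite mem_cat max_entry_mem.
have maxR : R != [::] -> max_entry R < m.
  by move=> R0; apply: lt_m; rewrite mem_cat max_entry_mem ?orbT.
move=> x; rewrite {1}vE -!catA.
have [L0|L0] := eqVneq L [::]; have [R0|R0] := eqVneq R [::].
- by rewrite L0 R0 /= => xP; rewrite mem_cat xP.
- rewrite L0 /= => xP; apply: IH => //=.
  by rewrite maxR // !mem_cat xP !orbT.
- rewrite R0 /= => xP; apply: IH => //=.
  by rewrite maxL // !mem_cat -cats1 xP !orbT.
move=> xP; apply: (IH) => //; apply: (IH) => //=.
by rewrite maxR // maxL // !mem_cat xP !orbT.
Qed.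

Lemma mem_parses v w : uniq w -> w != [::] ->
  (v \in parses [::] w) = (stack_sort v == w).
Proof.
move=> uw w0; apply/idP/eqP => [/parses_sound-> //|vw].
have pvw : perm_eq v w by rewrite -vw perm_sym perm_stack_sort.
rewrite -vw -[stack_sort v]cats0; apply: parses_complete.
- by rewrite (perm_uniq pvw).
- by rewrite -size_eq0 (perm_size pvw) size_eq0.
by rewrite inE.
Qed.

(** Merging keeps the order inside each tree, so its reading survives in the result; this later
    tells a left child from a right one. *)
Lemma parses_subseq p v st w : p \in st -> v \in parses st w -> subseq p.2 v.
Proof.
have sub_cons (a : nat) x : subseq x (a :: x) by exact: subseq_cons.
elim: w p st => [|a w IH] p st /=.
  by case: st => [|q [|? ?]] //; rewrite !inE => /eqP-> /eqP->.
move=> p_st; rewrite mem_cat => /orP[/IH|]; first by apply; rewrite inE p_st orbT.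
case: st p_st => [|q st] //=; case: ifP => // _ p_st.
have here x st1 : v \in parses ((a, x) :: st1) w -> subseq x v.
  by move=> vP; apply: (IH (a, x) _ _ vP); rewrite mem_head.
have there x st1 : p \in st1 -> v \in parses ((a, x) :: st1) w -> subseq p.2 v.
  by move=> p1; apply: IH; rewrite inE p1 orbT.
move: p_st; rewrite inE !mem_cat => /orP[/eqP->|p_st].
  move=> /orP[/here|/orP[/here|]].
  - exact/subseq_trans/subseq_rcons.
  - exact/subseq_trans.
  case: st => [|r st] //; case: ifP => // _ /here; apply: subseq_trans.
  by rewrite -cat_rcons suffix_subseq.
move=> /orP[/there->//|/orP[/there->//|]].
case: st p_st => [|r st] //; case: ifP => // _.
rewrite inE => /orP[/eqP->|p_st]; last exact: there.
by move=> /here; apply: subseq_trans; rewrite prefix_subseq.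
Qed.

(** * Counting runs and the greedy run *)

Fixpoint parse_count (s w : seq nat) : nat :=
  if w is a :: w' then
    parse_count (a :: s) w' +
    (if s is t :: s1 then
       if t < a then
         (parse_count (a :: s1) w').*2 +
         (if s1 is t2 :: s2 then
            if t2 < a then parse_count (a :: s2) w' else 0
          else 0)
       else 0
     else 0)
  else size s == 1.

(** The roots alone decide which moves are possible, and a left or right child gives the same roots,
    hence the doubling in [parse_count]. *)
Lemma size_parses st w : size (parses st w) = parse_count (map fst st) w.
Proof.
elim: w st => [|a w IH] [|p st] //=; first by case: st.
  by rewrite cats0 IH addn0.
rewrite size_cat IH; case: ifP => //= _; rewrite !size_cat !IH /= -addnn.
by case: st => [|q st] //=; rewrite -?addnA //; case: ifP; rewrite ?IH.
Qed.

(** The run is imitated without [t]. The entry just above [t] only ever grows, so [t] can only be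
    consumed as the second tree of a two-tree merge, which becomes a one-tree merge. *)
Lemma parse_count_merge l t a s w : t < a ->
  0 < parse_count (l ++ a :: t :: s) w -> 0 < parse_count (l ++ a :: s) w.
Proof.
elim: w l t a s => [|b w IH] l t a s lt_ta /=.
  by rewrite size_cat /= addnS addnS.
have push l' : 0 < parse_count (b :: l' ++ a :: t :: s) w ->
    0 < parse_count (b :: l' ++ a :: s) w by apply: (IH (b :: l')).
rewrite !addn_gt0 => /orP[/push->//|].
case: l {push} => [|c l] /=.
  case: ifP => // lt_ab; rewrite !addn_gt0 !double_gt0 => /orP[|].
    by move=> /(IH [::] t b s (ltn_trans lt_ta lt_ab)) /= ->; rewrite orbT.
  by case: ifP => // _ ->; rewrite orbT.
case: ifP => // lt_cb; rewrite !addn_gt0 !double_gt0 => /orP[|].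
  by move=> /(IH (b :: l) t a s lt_ta) /= ->; rewrite orbT.
case: l => [|d l] /=.
  case: ifP => // lt_ab /(IH [::] t b s (ltn_trans lt_ta lt_ab)) /= ->.
  by rewrite !orbT.
by case: ifP => // _ /(IH (b :: l) t a s lt_ta) /= ->; rewrite !orbT.
Qed.

(* The top of the stack is the last letter read, so [t < a] is an ascent. *)
Fixpoint greedy (s w : seq nat) : option (seq nat) :=
  if w is a :: w' then
    if s is t :: s1 then
      if t < a then
        if s1 is t2 :: s2 then if t2 < a then greedy (a :: s2) w' else None
        else None
      else greedy (a :: s) w'
    else greedy [:: a] w'
  else Some s.

Definition greedy_accepts (w : seq nat) : bool :=
  omap size (greedy [::] w) == Some 1.

(* The greedy stack shrinks as fast as possible, so a stack that is once
   deeper stays deeper and never reaches size 1. *)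
Lemma parse_count_deep x s st w :
  greedy (x :: s) w -> size s < size st -> parse_count (x :: st) w = 0.
Proof.
elim: w x s st => [|a w IH] x s st /=; first by case: st.
case: ifP => [lt_xa|_]; last by move=> /IH gw lt_s; rewrite gw.
case: s => [|t2 s] //; case: ifP => // _ gw /= lt_s.
rewrite (IH _ _ _ gw) ?(IH _ _ _ gw) //=; try lia.
by case: st lt_s => [|t st] //= lt_s; case: ifP => // _; apply: IH gw _.
Qed.

(** At an ascent, shifting or merging a single tree leaves a deeper stack than the greedy move, so
    by [parse_count_deep] these branches count zero. *)
Lemma parse_count_greedy s w :
  omap size (greedy s w) = Some 1 -> parse_count s w = 1.
Proof.
elim: w s => [|a w IH] s /=; first by move=> [->].
case: s => [|t s] /=; first by move=> /IH->.
case: ifP => [lt_ta|_]; last by move=> /IH->.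
case: s => [|t2 s] //; case: ifP => // _ gw; have {}gw' : greedy (a :: s) w.
  by case: greedy gw.
by rewrite (IH _ gw) !(parse_count_deep gw') //= ltnS leqnSn.
Qed.

Lemma parses_perm v st w :
  v \in parses st w -> perm_eq v (flatten (map snd st) ++ w).
Proof.
elim: w st => [|a w IH] st /=.
  by case: st => [|p [|? ?]] //; rewrite inE => /eqP->; rewrite /= !cats0.
have via x st1 : v \in parses ((a, x) :: st1) w ->
    (forall P, count P (flatten (map snd st) ++ a :: w)
               = count P x + count P (flatten (map snd st1)) + count P w) ->
    perm_eq v (flatten (map snd st) ++ a :: w).
  by move=> /IH/permP vP e; apply/permP => P; rewrite vP e /= !count_cat.
rewrite mem_cat => /orP[/via|]; first by apply=> P; rewrite !count_cat /=; lia.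
case: st via => [|p st] //= via; case: ifP => // _.
rewrite !mem_cat => /orP[/via|/orP[/via|]].
- by apply=> P; rewrite -cats1 !count_cat /=; lia.
- by apply=> P; rewrite !count_cat /=; lia.
case: st via => [|q st] //= via; case: ifP => // _ /via.
by apply=> P; rewrite !count_cat /=; lia.
Qed.

(** At an ascent, a one-tree merge that can be completed would yield two readings, and a shift that
    can be completed would allow such a merge by [parse_count_merge]. Only the greedy two-tree merge
    remains. *)
Lemma parses_greedy st w : uniq (flatten (map snd st) ++ w) ->
    all (fun p => p.2 != [::]) st -> 0 < parse_count (map fst st) w ->
    (forall u v, u \in parses st w -> v \in parses st w -> u = v) ->
  omap size (greedy (map fst st) w) = Some 1.
Proof.
have some_parse st' w' : 0 < parse_count (map fst st') w' ->
    exists v, v \in parses st' w'.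
  rewrite -size_parses; case: parses => // v l _.
  by exists v; rewrite mem_head.
elim: w st => [|a w IH] st uw nst /=; first by move=> /[!lt0b] /eqP->.
have shift : 0 < parse_count (a :: map fst st) w ->
    (forall u v, u \in parses ((a, [:: a]) :: st) w ->
                 v \in parses ((a, [:: a]) :: st) w -> u = v) ->
    omap size (greedy (a :: map fst st) w) = Some 1.
  apply: (IH ((a, [:: a]) :: st)); rewrite ?nst //=.
  by move: uw; rewrite -cat1s uniq_catCA.
case: st uw nst shift => [|p st] /= uw nst shift c0 up.
  by apply: shift; rewrite ?cats0 in up *; first by rewrite addn0 in c0.
move: c0 up shift; case: ifP => [lt_pa c0 up _|_ c0 up]; last first.
  by apply; [rewrite addn0 in c0 | rewrite cats0 in up].
have [p0 pst0] := andP nst.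
have uw2 v x st1 : v \in parses ((a, x) :: st1) w ->
    perm_eq ((p.2 ++ flatten (map snd st)) ++ a :: w)
            (x ++ flatten (map snd st1) ++ w) -> uniq v.
  by move=> /parses_perm/perm_uniq-> /= /perm_uniq; rewrite uw catA => <-.
have merge0 : parse_count (a :: map fst st) w = 0.
  apply/eqP; rewrite -leqn0 leqNgt; apply/negP => c1.
  have [u uP] := some_parse ((a, rcons p.2 a) :: st) w c1.
  have [v vP] := some_parse ((a, a :: p.2) :: st) w c1.
  have uv : u = v by apply: up; rewrite !mem_cat ?uP ?vP !orbT.
  have uu : uniq u.
    by apply: uw2 uP _; apply/permP => P; rewrite -cats1 !count_cat /=; lia.
  (* With distinct letters a subsequence of [u] is determined by its set of letters, so the two
     child positions would give the same word although [p.2] is nonempty. *)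
  have /(subseq_uniqP uu) e1 := parses_subseq (mem_head _ _) uP.
  rewrite -uv in vP.
  have /(subseq_uniqP uu) e2 := parses_subseq (mem_head _ _) vP.
  have : rcons p.2 a = a :: p.2.
    by rewrite [LHS]e1 [RHS]e2; apply: eq_filter => x; rewrite /= mem_rcons.
  case: (p.2) p0 uw => // b l _ + [ba _].
  by rewrite ba /= mem_cat inE eqxx orbT.
have merge1 : parse_count (a :: p.1 :: map fst st) w = 0.
  apply/eqP; rewrite -leqn0 leqNgt; apply/negP.
  by move=> /(@parse_count_merge [::] _ _ _ _ lt_pa) /=; rewrite merge0.
move: c0; rewrite merge1 merge0 /=.
case: st uw pst0 up uw2 {nst merge0 merge1} => [|q st] //= uw /andP[_ st0] up uw2.
case: ifP up => // lt_qa up c0.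
apply: (IH ((a, q.2 ++ a :: p.2) :: st)) => //=.
- rewrite -(@perm_uniq _ ((p.2 ++ q.2 ++ flatten (map snd st)) ++ a :: w)) //.
  by apply/permP => P; rewrite !count_cat /=; lia.
- by case: (q.2).
- by move=> u v uP vP; apply: up; rewrite !mem_cat ?uP ?vP !orbT.
Qed.

Lemma uniquely_sorted_greedy w : is_permutation w -> w != [::] ->
  uniquely_sorted w = greedy_accepts w.
Proof.
move=> pw w0; have /andP[uw _] := pw.
have pE v : (v \in parses [::] w) = (stack_sort v == w) by apply: mem_parses.
apply/(uniquely_sortedP pw)/eqP => [[v [[_ /eqP vw] v_uniq]]|].
  apply: (@parses_greedy [::]) => //.
    by rewrite -size_parses lt0n size_eq0; apply/eqP => p0; rewrite -pE p0 in vw.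
  suff vE u : u \in parses [::] w -> u = v by move=> u1 u2 /vE-> /vE->.
  rewrite pE => /eqP uw'; rewrite (v_uniq u) //; split=> //.
  have puw : perm_eq u w by rewrite -uw' perm_sym perm_stack_sort.
  by rewrite /is_permutation (perm_uniq puw) (perm_mem puw).
move=> /parse_count_greedy; rewrite -(size_parses [::]) => s1.
case: parses s1 pE => [|v [|]] // _ pE.
exists v; split=> [|u [_ /eqP]]; last by rewrite -pE inE => /eqP.
have vw : stack_sort v == w by rewrite -pE mem_head.
split; last exact/eqP.
have pvw : perm_eq v w by rewrite -(eqP vw) perm_sym perm_stack_sort.
by rewrite /is_permutation (perm_uniq pvw) (perm_mem pvw).
Qed.

(** * Permutations avoiding 231 and 4132 as words *)

Lemma subseq_catP (T : eqType) (s s1 s2 : seq T) : subseq s (s1 ++ s2) ->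
  exists t1 t2, [/\ s = t1 ++ t2, subseq t1 s1 & subseq t2 s2].
Proof.
case/subseqP=> m sm ->; rewrite -(cat_take_drop (size s1) m) mask_cat.
  exists (mask (take (size s1) m) s1), (mask (drop (size s1) m) s2).
  by split=> //; apply: mask_subseq.
by rewrite size_takel // sm size_cat leq_addr.
Qed.

Lemma iota1S n : iota 1 n.+1 = rcons (iota 1 n) n.+1.
Proof. by have := iotaD 1 n 1; rewrite addn1 cats1. Qed.

Definition avoids_132 (w : seq nat) : Prop :=
  forall x y z, subseq [:: x; y; z] w -> ~~ (x < z < y).
Definition avoids_231 (w : seq nat) : Prop :=
  forall x y z, subseq [:: x; y; z] w -> ~~ (z < x < y).
Definition avoids_4132 (w : seq nat) : Prop :=
  forall x y z t, subseq [:: x; y; z; t] w -> ~~ [&& y < t, t < z & z < x].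

Lemma avoids_231P w : avoids w [:: 2; 3; 1] <-> avoids_231 w.
Proof.
split=> [avw x y z sub|avw].
  apply: contra avw => /andP[lt_zx lt_xy]; apply/containsP.
  exists [:: x; y; z] => //; rewrite /same_relative_order /=.
  by apply/forallP=> -[[|[|[|//]]] ?]; apply/forallP=> -[[|[|[|//]]] ?] /=; lia.
apply/containsP => -[u sub /andP[/eqP]].
case: u sub => [|x [|y [|z [|]]]] //= sub _ /forallP H.
have /forallP/(_ (Ordinal (isT : 1 < 3)))/eqP /= H01 :=
  H (Ordinal (isT : 0 < 3)).
have /forallP/(_ (Ordinal (isT : 0 < 3)))/eqP /= H20 :=
  H (Ordinal (isT : 2 < 3)).
by have := avw _ _ _ sub; rewrite H01 H20.
Qed.

Lemma avoids_4132P w : avoids w [:: 4; 1; 3; 2] <-> avoids_4132 w.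
Proof.
split=> [avw x y z t sub|avw].
  apply: contra avw => /and3P[lt_yt lt_tz lt_zx]; apply/containsP.
  exists [:: x; y; z; t] => //; rewrite /same_relative_order /=.
  by apply/forallP=> -[[|[|[|[|//]]]] ?];
    apply/forallP=> -[[|[|[|[|//]]]] ?] /=; lia.
apply/containsP => -[u sub /andP[/eqP]].
case: u sub => [|x [|y [|z [|t [|]]]]] //= sub _ /forallP H.
have /forallP/(_ (Ordinal (isT : 3 < 4)))/eqP /= H13 :=
  H (Ordinal (isT : 1 < 4)).
have /forallP/(_ (Ordinal (isT : 2 < 4)))/eqP /= H32 :=
  H (Ordinal (isT : 3 < 4)).
have /forallP/(_ (Ordinal (isT : 0 < 4)))/eqP /= H20 :=
  H (Ordinal (isT : 2 < 4)).
by have := avw _ _ _ _ sub; rewrite H13 H32 H20.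
Qed.

(** * The encoding by letters and its invariant *)

Variant letter := Front | Back | Close.

Definition letter_code (l : letter) : nat :=
  match l with Front => 0 | Back => 1 | Close => 2 end.
Definition letter_decode (n : nat) : letter :=
  match n with 0 => Front | 1 => Back | _ => Close end.
Lemma letter_codeK : cancel letter_code letter_decode. Proof. by case. Qed.
HB.instance Definition _ := Equality.copy letter (can_type letter_codeK).

(* The closed blocks, followed by the values of the current block. *)
Definition state : Type := seq nat * seq nat.
Definition weight (s : state) : nat := size s.1 + size s.2.

Definition step (s : state) (l : letter) : state :=
  let x := (weight s).+1 in
  match l with
  | Front => (s.1, x :: s.2)
  | Back => (s.1, rcons s.2 x)
  | Close => (s.1 ++ x :: s.2, [::])
  end.

Definition build : state -> seq letter -> state := foldl step.

(** Closing puts a larger value in front of the open block and would turn a 132 there into a 4132,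
    hence [wf_open_132]. *)
Record wf (s : state) : Prop := Wf {
  wf_perm : perm_eq (s.1 ++ s.2) (iota 1 (weight s));
  wf_lt : forall x y, x \in s.1 -> y \in s.2 -> x < y;
  wf_231 : avoids_231 s.1;
  wf_4132 : avoids_4132 s.1;
  wf_open_231 : avoids_231 s.2;
  wf_open_132 : avoids_132 s.2 }.

Lemma weight_step s l : weight (step s l) = (weight s).+1.
Proof. by case: l; rewrite /weight /= ?size_rcons ?size_cat /=; lia. Qed.

Lemma wf_new s x : wf s -> x \in s.1 ++ s.2 -> x < (weight s).+1.
Proof. by move=> /wf_perm/perm_mem->; rewrite mem_iota add1n => /andP[]. Qed.

Lemma avoids_231_sub u v : subseq u v -> avoids_231 v -> avoids_231 u.
Proof. by move=> uv av x y z /subseq_trans/(_ uv); apply: av. Qed.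

Lemma avoids_4132_sub u v : subseq u v -> avoids_4132 v -> avoids_4132 u.
Proof. by move=> uv av x y z t /subseq_trans/(_ uv); apply: av. Qed.

Lemma avoids_132_sub u v : subseq u v -> avoids_132 v -> avoids_132 u.
Proof. by move=> uv av x y z /subseq_trans/(_ uv); apply: av. Qed.

Lemma subseq_consE (T : eqType) (x y : T) s w :
  subseq (x :: s) (y :: w) -> (x = y /\ subseq s w) \/ subseq (x :: s) w.
Proof. by rewrite /=; case: eqP => [->|_]; [left|right]. Qed.

Lemma avoids_231_front n w : {in w, forall x, x < n} ->
  avoids_231 w -> avoids_231 (n :: w).
Proof.
move=> ltn av x y z /subseq_consE[[-> /mem_subseq sub]|/av//].
by have := ltn y (sub y (mem_head _ _)); lia.
Qed.

Lemma avoids_132_front n w : {in w, forall x, x < n} ->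
  avoids_132 w -> avoids_132 (n :: w).
Proof.
move=> ltn av x y z /subseq_consE[[-> /mem_subseq sub]|/av//].
by have := ltn y (sub y (mem_head _ _)); lia.
Qed.

Lemma subseq_rconsE (T : eqType) (x y : T) s w :
  subseq (rcons s x) (rcons w y) ->
  (x = y /\ subseq s w) \/ subseq (rcons s x) w.
Proof.
rewrite -subseq_rev !rev_rcons => /subseq_consE[[-> ]|].
  by rewrite subseq_rev; left.
by rewrite -rev_rcons subseq_rev; right.
Qed.

Lemma avoids_231_back n w : {in w, forall x, x < n} ->
  avoids_231 w -> avoids_231 (rcons w n).
Proof.
move=> ltn av x y z /(@subseq_rconsE _ z n [:: x; y])[[-> /mem_subseq sub]|/av//].
by have := ltn x (sub x (mem_head _ _)); lia.
Qed.

Lemma avoids_132_back n w : {in w, forall x, x < n} ->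
  avoids_132 w -> avoids_132 (rcons w n).
Proof.
move=> ltn av x y z /(@subseq_rconsE _ z n [:: x; y])[[-> /mem_subseq sub]|/av//].
by have := ltn y (sub y _); rewrite !inE eqxx orbT => /(_ isT); lia.
Qed.

Lemma wf_close s : wf s -> forall x y, x \in s.1 ->
  y \in (weight s).+1 :: s.2 -> x < y.
Proof.
move=> ws x y xC; rewrite inE => /orP[/eqP->|]; last exact: wf_lt ws _ _ xC.
by apply: wf_new ws _; rewrite mem_cat xC.
Qed.

Lemma wf_step s l : wf s -> wf (step s l).
Proof.
move=> ws; have lt_new := wf_new ws; have lt_close := wf_close ws.
have open_new : {in s.2, forall x, x < (weight s).+1}.
  by move=> x xV; apply: lt_new; rewrite mem_cat xV orbT.
have [pm lt a231 a4132 v231 v132] := ws.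
have pmS : perm_eq (rcons (s.1 ++ s.2) (weight s).+1) (iota 1 (weight s).+1).
  by rewrite iota1S -!cats1 perm_cat2r.
split; rewrite ?weight_step.
- rewrite -(permPr pmS); apply/permP => P.
  by case: l; rewrite /= -?cats1 !count_cat /= ?count_cat /=; lia.
- by case: l => //= x y xC; rewrite ?mem_rcons; apply: lt_close.
(* A 231 or 4132 straddling the boundary would have its first letter in the closed part and its
   smaller last letter in the block, against [lt_close]. *)
- case: l => //= x y z /subseq_catP[t1 [t2 [e s1 s2]]].
  case: t1 e s1 => [|x' [|y' [|z' t1]]] /=.
  + by move=> e _; move: s2; rewrite -e; apply: avoids_231_front.
  + move=> [<- e] /mem_subseq sx; have zt : z \in t2 by rewrite -e !inE eqxx orbT.
    have := lt_close x z (sx _ (mem_head _ _)) (mem_subseq s2 zt); lia.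
  + move=> [<- _ e] /mem_subseq sx; have zt : z \in t2 by rewrite -e mem_head.
    have := lt_close x z (sx _ (mem_head _ _)) (mem_subseq s2 zt); lia.
  + by move=> [<- <- <-]; case: t1 t2 s2 => [|? ?] [|? ?] // _ _; apply: a231.
- case: l => //= x y z t /subseq_catP[t1 [t2 [e s1 s2]]].
  have [t1E|t1n] := eqVneq t1 [::].
    rewrite t1E /= in e; rewrite -e in s2.
    (* Inside the block, the last three letters of a 4132 form a 132 of the open part. *)
    have [[-> /v132]|s4] := subseq_consE s2; first by lia.
    have := v132 y z t (subseq_trans (subseq_cons _ x) s4); lia.
  have xt1 : x \in t1 by case: t1 t1n e {s1} => // ? ? _ [<- _]; apply: mem_head.
  have [t2E|t2n] := eqVneq t2 [::].
    by apply: a4132; rewrite e t2E cats0.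
  have tt2 : t \in t2.
    have := congr1 (last 0) e; rewrite last_cat /= => ->.
    by case: t2 t2n {e s2} => // ? ? _; apply: mem_last.
  have := lt_close x t (mem_subseq s1 xt1) (mem_subseq s2 tt2); lia.
- by case: l => //=; [apply: avoids_231_front | apply: avoids_231_back].
- by case: l => //=; [apply: avoids_132_front | apply: avoids_132_back].
Qed.

Lemma wf_build s u : wf s -> wf (build s u).
Proof. by elim: u s => //= l u IH s /(wf_step l)/IH. Qed.

Lemma weight_build s u : weight (build s u) = weight s + size u.
Proof. by elim: u s => [|l u IH] s /=; rewrite ?addn0 // IH weight_step addnS. Qed.

Lemma wf_nil : wf ([::], [::]).
Proof. by split=> //= x y z; rewrite /= ?negbK. Qed.

(** The last move is read off from the largest value m. If no block is open, write C = C1 m V1: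
    avoiding 231 puts C1 below V1 and avoiding 4132 makes V1 avoid 132, so [Close] is undone. In an
    open block, a letter before m and one after it would form a 231 or a 132 with m, so m is at an
    end; a one-letter block is undone by [Front]. *)
Lemma wf_unstep s : wf s -> 0 < weight s -> exists s' l,
  [/\ wf s', s = step s' l & l = Back -> s'.2 != [::]].
Proof.
case: s => C V ws.
case nE: (weight (C, V)) => [|n] // _.
have [pm lt a231 a4132 v231 v132] := ws; rewrite /= nE in pm lt a231 a4132 v231 v132.
have pmS C' V' : perm_eq (C ++ V) (n.+1 :: C' ++ V') ->
    perm_eq (C' ++ V') (iota 1 n).
  move=> pm'; rewrite -(perm_cons n.+1) -(permPl pm') (permPl pm).
  by rewrite iota1S perm_rcons.
have sizeS C' V' : perm_eq (C' ++ V') (iota 1 n) -> weight (C', V') = n.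
  by move=> /perm_size; rewrite size_cat size_iota.
have uCV : uniq (C ++ V) by rewrite (perm_uniq pm) iota_uniq.
have le_n x : x \in C ++ V -> x <= n.+1.
  by rewrite (perm_mem pm) mem_iota; lia.
have n_in : n.+1 \in C ++ V by rewrite (perm_mem pm) mem_iota; lia.
have [V0|V0] := eqVneq V [::].
  rewrite V0 cats0 in n_in uCV le_n pmS.
  have [C1 [V1 CE]] : exists C1 V1, C = C1 ++ n.+1 :: V1.
    have /path.splitP[C1 V1] := n_in; exists C1, V1; by rewrite cat_rcons.
  have pm' : perm_eq (C1 ++ V1) (iota 1 n).
    by apply: pmS; rewrite CE -cat1s perm_catCA.
  have uC1 : uniq (n.+1 :: C1 ++ V1).
    by move: uCV; rewrite CE -cat1s uniq_catCA.
  have sC1 : subseq C1 C by rewrite CE prefix_subseq.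
  have sV1 : subseq (n.+1 :: V1) C by rewrite CE suffix_subseq.
  have sV1' := subseq_trans (subseq_cons _ _) sV1.
  have lt_n x : x \in C1 ++ V1 -> x < n.+1.
    by rewrite (perm_mem pm') mem_iota; lia.
  exists (C1, V1), Close; split=> //; last by rewrite /step sizeS //= -CE V0.
  split; rewrite /= ?sizeS //.
  - move=> x y xC yV; have sxy : subseq [:: x; n.+1; y] C.
      by rewrite CE -[[:: x; _; _]]/([:: x] ++ [:: n.+1; y]) cat_subseq //=
        ?eqxx sub1seq.
    have := a231 _ _ _ sxy; have := lt_n x; rewrite mem_cat xC => /(_ isT).
    have : x != y; last by lia.
    apply: contraTneq uC1 => xy; rewrite /= cat_uniq.
    have -> : has (mem C1) V1 by apply/hasP; exists y; rewrite //= -xy.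
    by rewrite !andbF.
  - exact: avoids_231_sub a231.
  - exact: avoids_4132_sub a4132.
  - exact: avoids_231_sub a231.
  - move=> x y z sub; have sn : subseq [:: n.+1; x; y; z] C.
      by apply: subseq_trans sV1; rewrite /= eqxx.
    have := a4132 _ _ _ _ sn; have : y < n.+1; last by lia.
    by apply: lt_n; rewrite mem_cat (mem_subseq sub) ?orbT // !inE eqxx orbT.
have [A [B VE]] : exists A B, V = A ++ n.+1 :: B.
  have nV : n.+1 \in V.
    move: n_in; rewrite mem_cat => /orP[nC|//].
    case: V V0 lt le_n {ws pm pmS v231 v132 uCV nE} => // v V _ lt le_n.
    have := lt _ _ nC (mem_head _ _).
    by rewrite ltnNge le_n // mem_cat mem_head orbT.
  by have /path.splitP[A B] := nV; exists A, B; rewrite cat_rcons.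
have pm' : perm_eq (C ++ A ++ B) (iota 1 n).
  by apply: pmS; rewrite VE -[n.+1 :: B]cat1s catA perm_catCA /= -catA.
have lt_n x : x \in C ++ A ++ B -> x < n.+1.
  by rewrite (perm_mem pm') mem_iota; lia.
have sAB : subseq (A ++ B) V by rewrite VE cat_subseq // subseq_cons.
have wAB : wf (C, A ++ B).
  split; rewrite ?(sizeS _ _ pm') //=.
  - by move=> x y xC /(mem_subseq sAB); apply: lt.
  - exact: avoids_231_sub v231.
  - exact: avoids_132_sub v132.
case: A VE wAB pm' lt_n {sAB} => [|a A] VE wAB pm' lt_n.
  by exists (C, B), Front; split=> //; rewrite /step /= (sizeS _ _ pm') VE.
case/lastP: B VE wAB pm' lt_n => [|B b] VE wAB pm' lt_n.
  rewrite cats0 in wAB pm'.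
  exists (C, a :: A), Back; split=> //.
  by rewrite /step (sizeS _ _ pm') VE -cats1.
have sab : subseq [:: a; n.+1; b] V.
  rewrite VE /= eqxx -[[:: n.+1; b]]cat0s cat_subseq ?sub0seq //= eqxx.
  by rewrite -cats1 suffix_subseq.
have [a_in b_in] : a \in C ++ (a :: A) ++ rcons B b /\
                   b \in C ++ (a :: A) ++ rcons B b.
  by split; rewrite !mem_cat ?mem_rcons ?mem_head ?orbT.
have := v231 _ _ _ sab; have := v132 _ _ _ sab.
have := lt_n _ a_in; have := lt_n _ b_in.
suff : a != b by lia.
move: uCV; rewrite VE cat_uniq => /and3P[_ _ /andP[na _]].
by apply: contraNneq na => ->; rewrite mem_cat inE mem_rcons mem_head !orbT.
Qed.

(* On an empty block, Front and Back coincide; legal words use Front. *)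
Definition legal (s : state) (u : seq letter) : bool :=
  path (fun k l => ~~ ((k == Close) && (l == Back)))
       (if s.2 == [::] then Close else Front) u.

Lemma legal_cons s l u :
  legal s (l :: u) = ~~ ((s.2 == [::]) && (l == Back)) && legal (step s l) u.
Proof.
by rewrite /legal; case: s => C [|v V]; case: l; case: u => [|[] u].
Qed.

Lemma legal_rcons s u l : legal s (rcons u l) =
  legal s u && ~~ (((build s u).2 == [::]) && (l == Back)).
Proof.
elim: u s => [|k u IH] s; first by rewrite legal_cons /= andbT.
by rewrite rcons_cons !legal_cons IH andbA.
Qed.

Lemma wf_built s : wf s ->
  exists2 u, legal ([::], [::]) u & build ([::], [::]) u = s.
Proof.
have [n] := ubnP (weight s); elim: n s => // n IH s lt_n ws.
have [s0|s0] := posnP (weight s).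
  by case: s s0 {lt_n ws} => [[|? ?] [|? ?]] //; exists [::].
have [s' [l [ws' sE lB]]] := wf_unstep ws s0.
have [|u lu uE] := IH s' _ ws'; first by move: lt_n; rewrite sE weight_step.
exists (rcons u l); last by rewrite /build foldl_rcons -/(build _ _) uE.
by rewrite legal_rcons lu uE; case: l lB {sE} => [_|/(_ erefl)|_]; rewrite ?andbF ?andbT.
Qed.

(** The position of the largest value tells the last letter; [Front] and [Back] agree only when they
    create a one-letter block, where the side conditions exclude [Back]. *)
Lemma step_inj s s' l l' : wf s -> wf s' -> step s l = step s' l' ->
  ~~ ((s.2 == [::]) && (l == Back)) -> ~~ ((s'.2 == [::]) && (l' == Back)) ->
  s = s' /\ l = l'.
Proof.
move=> ws ws' e; have := congr1 weight e; rewrite !weight_step => -[we].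
have lt_new := wf_new ws; have lt_new' := wf_new ws'.
rewrite -we in lt_new'.
case: s s' l l' e we ws ws' lt_new lt_new' => C V [C' V'] l l' + we _ _.
rewrite /step -we => + lt_new lt_new'; set n := (weight _).+1 in lt_new lt_new' *.
have nV : n \notin C ++ V by apply/negP => /lt_new; rewrite ltnn.
have nV' : n \notin C' ++ V' by apply/negP => /lt_new'; rewrite ltnn.
have front_back U U' : n \notin U' -> n :: U = rcons U' n -> U' = [::].
  by case: U' => // a U'; rewrite inE negb_or => /andP[/eqP + _] [].
move: nV nV'; rewrite !mem_cat !negb_or => /andP[nC nV] /andP[nC' nV'].
case: l l' => [] [] /= [].
- by move=> -> ->.
- by move=> _ /(front_back _ _ nV')->.
- by [].
- by move=> _ /esym/(front_back _ _ nV)->.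
- by move=> -> /rcons_inj[->].
- by move=> _ /(congr1 size); rewrite size_rcons.
- by [].
- by move=> _ /(congr1 size); rewrite size_rcons.
move=> CE _ _; have : index n (C ++ n :: V) = index n (C' ++ n :: V').
  by rewrite CE.
rewrite !index_cat (negPf nC) (negPf nC') /= eqxx !addn0 => sC.
by move/eqP: CE; rewrite eqseq_cat // => /andP[/eqP-> /eqP[->]].
Qed.

Lemma build_inj u u' : size u = size u' ->
  legal ([::], [::]) u -> legal ([::], [::]) u' ->
  build ([::], [::]) u = build ([::], [::]) u' -> u = u'.
Proof.
elim/last_ind: u u' => [|u l IH] u'; first by case: u'.
case/lastP: u' => [|u' l']; rewrite !size_rcons // => -[su].
rewrite !legal_rcons => /andP[lu ll] /andP[lu' ll'].
rewrite /build !foldl_rcons -!/(build _ _) => e.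
have [||e1 ->] := step_inj _ _ e ll ll'; try exact/wf_build/wf_nil.
by rewrite (IH u').
Qed.

(** * The greedy parser on words *)

Lemma greedy_cat s u v : greedy s (u ++ v) = obind (greedy^~ v) (greedy s u).
Proof.
elim: u s => [|a u IH] [|t s] //=; case: ifP => _ //.
by case: s => [|t2 s] //; case: ifP.
Qed.

Lemma greedy_sub s s' w : greedy s w = Some s' -> {subset s' <= s ++ w}.
Proof.
elim: w s => [|a w IH] s /=; first by move=> [->] x; rewrite cats0.
case: s => [|t s] /=; first by move=> /IH.
case: ifP => _; last first.
  by move=> /IH sub x /sub; rewrite !(inE, mem_cat); lia.
case: s => [|t2 s] //; case: ifP => // _ /IH sub x /sub.
by rewrite !(inE, mem_cat); lia.
Qed.

(** An entry above all coming letters acts as the bottom of the stack: a letter that meets it is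
    shifted, and a merge that would need it fails as on an exhausted stack. *)
Lemma greedy_frame s x s' w : {in w, forall y, y < x} ->
  greedy (s ++ x :: s') w = omap (cat^~ (x :: s')) (greedy s w).
Proof.
elim: w s => [|a w IH] s ltx //=.
have {}IH l : greedy (l ++ x :: s') w = omap (cat^~ (x :: s')) (greedy l w).
  by apply: IH => y yw; apply: ltx; rewrite inE yw orbT.
have le_ax : (x < a) = false.
  by apply/negbTE; rewrite -leqNgt ltnW // ltx ?mem_head.
case: s => [|t s] /=; first by rewrite le_ax -(IH [:: a]).
case: ifP => _; last by rewrite -(IH (a :: t :: s)).
case: s => [|t2 s] /=; first by rewrite le_ax.
by case: ifP => // _; rewrite -(IH (a :: s)).
Qed.

(** A failed run cannot recover, and a closed part reduced to one tree lacks the second tree that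
    the next maximum has to merge. *)
Definition dead (s : state) : Prop :=
  [\/ greedy [::] s.1 = None, greedy [::] s.2 = None
    | exists t, greedy [::] s.1 = Some [:: t]].

(* [l - g + 2] because closing the block merges two trees under its maximum; an
   empty closed part, where nothing is merged, counts as size 2. *)
Definition live (s : state) (l g : nat) : Prop := exists sC sV,
  [/\ greedy [::] s.1 = Some sC, greedy [::] s.2 = Some sV, size sV = g,
      g <= l & if s.1 == [::] then l = g else size sC = l - g + 2].

Lemma wf_open_lt s : wf s -> {in s.2, forall x, x < (weight s).+1}.
Proof. by move=> ws x xV; apply: wf_new ws _; rewrite mem_cat xV orbT. Qed.

Lemma wf_closed_lt s : wf s -> {in s.1, forall x, x < (weight s).+1}.
Proof. by move=> ws x xC; apply: wf_new ws _; rewrite mem_cat xC. Qed.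

Lemma greedy_lt s u x : {in u, forall y, y < x} ->
  greedy [::] u = Some s -> all (fun t => t < x) s.
Proof. by move=> ltx /greedy_sub sub; apply/allP => t /sub /ltx. Qed.

Lemma dead_close s : wf s -> dead s -> greedy [::] (step s Close).1 = None.
Proof.
move=> ws; have ltC := wf_closed_lt ws; have ltV := wf_open_lt ws.
rewrite /= greedy_cat => -[->//|VN|[t gC]].
  case gC: greedy => [sC|] //=; have := greedy_lt ltC gC.
  case: sC gC => [|t [|t2 r]] _ /=.
  - by rewrite (@greedy_frame [::]) // VN.
  - by rewrite andbT => ->.
  - by move=> /and3P[-> -> _]; rewrite (@greedy_frame [::]) // VN.
rewrite gC /=; have /= := greedy_lt ltC gC.
by rewrite andbT => ->.
Qed.

Lemma dead_front s : wf s -> greedy [::] s.2 = None ->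
  greedy [::] (step s Front).2 = None.
Proof.
by move=> /wf_open_lt ltV VN; rewrite /= (@greedy_frame [::]) // VN.
Qed.

Lemma dead_step s l : wf s -> dead s -> dead (step s l).
Proof.
move=> ws ds; case: l; last by apply: Or31; apply: dead_close.
- case: ds => [CN|VN|tC]; [exact: Or31|apply: Or32|exact: Or33].
  exact: dead_front.
- case: ds => [CN|VN|tC]; [exact: Or31|apply: Or32|exact: Or33].
  by rewrite /= -cats1 greedy_cat VN.
Qed.

Lemma dead_rejects s u : wf s -> dead s ->
  greedy_accepts (step (build s u) Close).1 = false.
Proof.
elim: u s => [|l u IH] s ws ds /=; last exact/IH/dead_step/ds/ws/wf_step.
by rewrite /greedy_accepts dead_close.
Qed.

(** Under the new maximum two closed trees become one, and the [g] trees of the block lie above it: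
    (l - g + 2) - 1 + g = l + 1. With nothing closed, the maximum is itself the extra tree.
    Acceptance thus means l = 0. *)
Lemma live_close s l g : wf s -> live s l g ->
  exists2 r, greedy [::] (step s Close).1 = Some r & size r = l.+1.
Proof.
move=> ws [sC [sV [gC gV sVg le_gl lC]]].
have ltC := wf_closed_lt ws; have ltV := wf_open_lt ws.
rewrite /= greedy_cat gC /=; case: eqP lC gC => [-> -> [<-]|_ lC gC].
  rewrite (@greedy_frame [::]) // gV /=; eexists; first by [].
  by rewrite size_cat sVg addn1.
case: sC lC gC => [|t [|t2 r]] lC gC; try by move: lC => /=; lia.
have /= /and3P[-> -> _] := greedy_lt ltC gC.
rewrite (@greedy_frame [::]) // gV /=; eexists; first by [].
by move: lC; rewrite size_cat /= sVg; lia.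
Qed.

Lemma live_front s l g : wf s -> live s l g -> live (step s Front) l.+1 g.+1.
Proof.
move=> ws [sC [sV [gC gV sVg le_gl lC]]].
exists sC, (sV ++ [:: (weight s).+1]); split=> //=.
- by rewrite (@greedy_frame [::]) ?gV //; apply: wf_open_lt.
- by rewrite size_cat sVg addn1.
- by case: eqP lC => _ -> //; rewrite subSS.
Qed.

Lemma live_back s l g : wf s -> live s l g -> 1 < g ->
  live (step s Back) l.-1 g.-1.
Proof.
move=> ws [sC [sV [gC gV sVg le_gl lC]]] g1.
case: sV gV sVg => [|t [|t2 r]] gV sVg; try by move: sVg g1 => /= <-.
exists sC, ((weight s).+1 :: r); split=> //=.
- rewrite -cats1 greedy_cat gV /=.
  by have /= /and3P[-> -> _] := greedy_lt (wf_open_lt ws) gV.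
- by rewrite -sVg.
- by lia.
- by case: eqP lC => _ ->; lia.
Qed.

Lemma greedy_nil s w : greedy s w = Some [::] -> w = [::].
Proof.
elim: w s => [|a w IH] s //=; case: s => [|t s]; first by case: w IH => [|? ?] // IH /IH.
have nogo r : greedy (a :: r) w = Some [::] -> a :: w = [::].
  by case: w IH => [|? ?] // IH /IH.
by case: ifP => _; last exact: nogo; case: s => [|t2 s] //; case: ifP => // _ /nogo.
Qed.

Lemma live_back_dead s l g : wf s -> s.2 != [::] -> live s l g -> g <= 1 ->
  dead (step s Back).
Proof.
move=> ws V0 [sC [sV [_ gV sVg _ _]]] g1; apply: Or32.
rewrite /= -cats1 greedy_cat gV /=.
case: sV gV sVg => [/greedy_nil V0'|t [|t2 r]] gV; first by rewrite V0' in V0.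
  by have /= /andP[-> _] := greedy_lt (wf_open_lt ws) gV.
by move=> /= sVg; rewrite -sVg in g1.
Qed.

(** [Front] adds a tree at the bottom of the block, [Back] merges its two top trees, and [Close]
    starts an empty block. The guards exclude dead states: [Back] needs two trees, and closing at l
    = 0 would leave a single one. *)
Fixpoint accepted (l g : nat) (u : seq letter) : bool :=
  match u with
  | [::] => l == 0
  | Front :: u => accepted l.+1 g.+1 u
  | Back :: u => (1 < g) && accepted l.-1 g.-1 u
  | Close :: u => (0 < l) && accepted l.-1 0 u
  end.

Lemma accepts_build s u l g : wf s -> live s l g -> legal s u ->
  greedy_accepts (step (build s u) Close).1 = accepted l g u.
Proof.
elim: u s l g => [|k u IH] s l g ws lv.
  by move=> _; have [r gr sr] := live_close ws lv; rewrite /greedy_accepts gr /= sr.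
rewrite legal_cons => /andP[ok lu]; have wsk := wf_step k ws.
case: k ok lu wsk => /= ok lu wsk.
- by apply: IH => //; apply: live_front.
- case: ltnP => [g1|g1] /=; first by apply: IH => //; apply: live_back.
  by apply: dead_rejects => //; apply: live_back_dead lv g1; rewrite ?andbT in ok.
have [r gr sr] := live_close ws lv.
case: posnP => [l0|l0] /=.
  apply: dead_rejects => //; apply: Or33; move: sr; rewrite l0.
  by case: r gr => [|t []] // gr _; exists t.
apply: IH => //; exists r, [::]; split=> //.
by rewrite /= -size_eq0 size_cat sr /= addnS /= subn0; lia.
Qed.

(** [Back] is accepted only when the block has two trees, so never on an empty block. *)
Lemma accepted_legal s l g u : (s.2 == [::] -> g = 0) -> accepted l g u ->
  legal s u.
Proof.
elim: u s l g => [|k u IH] s l g s0 //; rewrite legal_cons.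
case: k => /=; rewrite ?andbF /=.
- by move=> /IH; apply.
- case: ltnP => //= g1 /IH acc; rewrite andbT; case: eqP s0 => [_ /(_ isT)|_ _] /=.
    by move: g1 => /[swap] ->.
  by apply: acc; rewrite -size_eq0 size_rcons.
- by move=> /andP[_ /IH]; apply.
Qed.

(** * Enumerating the accepted words *)

Fixpoint words (n l g : nat) : seq (seq letter) :=
  if n is m.+1 then
    map (cons Front) (words m l.+1 g.+1) ++
    (if 1 < g then map (cons Back) (words m l.-1 g.-1) else [::]) ++
    (if 0 < l then map (cons Close) (words m l.-1 0) else [::])
  else if l == 0 then [:: [::]] else [::].

Lemma mem_map_cons (T : eqType) (x y : T) u s :
  (x :: u \in map (cons y) s) = (x == y) && (u \in s).
Proof.
apply/mapP/andP => [[v vs [-> ->]]|[/eqP-> us]]; first by rewrite eqxx.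
by exists u.
Qed.

Lemma mem_words n l g u : (u \in words n l g) = (size u == n) && accepted l g u.
Proof.
elim: n l g u => [|n IH] l g u /=.
  by case: (l =P 0) => [->|/eqP/negbTE l0]; case: u => //=; rewrite l0.
rewrite !mem_cat; have nilE k s : ([::] \in map (cons k : seq letter -> _) s) = false.
  by apply/mapP => -[].
case: u => [|k u]; first by do 2![case: ifP => _]; rewrite ?nilE.
by case: k => /=; case: (1 < g); case: (0 < l);
  rewrite ?in_nil !mem_map_cons !IH /= ?orbF ?andbF ?eqSS.
Qed.

Lemma words_uniq n l g : uniq (words n l g).
Proof.
elim: n l g => [|n IH] l g /=; first by case: eqP.
have cons_inj (k : letter) : injective (cons k) by move=> u v [].
have disj (k k' : letter) s s' : k != k' ->
    has (mem (map (cons k) s)) (map (cons k') s') = false.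
  move=> kk'; apply/hasP => -[u /mapP[v _ ->]] /=.
  by rewrite mem_map_cons eq_sym (negPf kk').
rewrite !cat_uniq map_inj_uniq // IH has_cat.
have has_nil (s : seq (seq letter)) : has (mem [::]) s = false.
  by apply/hasP => -[].
by do 2![case: ifP => _]; rewrite ?disj ?has_nil ?map_inj_uniq ?IH.
Qed.

(** A complete permutation has no open block, so its word ends in [Close] and only the first n
    letters vary. Surjectivity comes from [wf_built], injectivity from [build_inj]. *)
Lemma U_words n : perm_eq (U n.+1 [:: 2; 3; 1] [:: 4; 1; 3; 2])
  [seq (step (build ([::], [::]) u) Close).1 | u <- words n 0 0].
Proof.
have live0 : live ([::], [::]) 0 0 by exists [::], [::].
have built u : wf (build ([::], [::]) u) by apply/wf_build/wf_nil.
have legalP u : u \in words n 0 0 -> size u = n /\ legal ([::], [::]) u.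
  by rewrite mem_words => /andP[/eqP-> /accepted_legal]; split=> //; auto.
apply: uniq_perm; first exact: U_uniq.
  rewrite map_inj_in_uniq ?words_uniq // => u v /legalP[su lu] /legalP[sv lv] e.
  apply: build_inj; rewrite ?su ?sv //.
  have {}e : step (build ([::], [::]) u) Close = step (build ([::], [::]) v) Close.
    by rewrite /step /= in e *; rewrite e.
  by have [] := step_inj (built u) (built v) e; rewrite ?andbF.
have pos m w : perm_eq w (iota 1 m.+1) -> is_permutation w && (w != [::]).
  move=> pw; rewrite /is_permutation (perm_uniq pw) iota_uniq (perm_mem pw).
  by rewrite mem_iota -size_eq0 (perm_size pw) size_iota.
move=> w; apply/idP/mapP => [|[u uW ->]].
  rewrite mem_U => /and4P[pw usw /avoids_231P a231 /avoids_4132P a4132].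
  have /andP[isw w0] := pos _ _ pw.
  have sw : weight (w, [::]) = n.+1 by rewrite /weight (perm_size pw) size_iota addn0.
  have ws : wf (w, [::]).
    by split=> //=; rewrite ?sw ?cats0 // => x y z; rewrite /= ?negbK.
  have [u lu uE] := wf_built ws.
  case/lastP: u lu uE => [|u k]; first by move=> _ [wE]; rewrite -wE in w0.
  rewrite legal_rcons => /andP[lu _]; rewrite /build foldl_rcons -/(build _ _).
  move=> uE; have kE : k = Close.
    by case: k uE => //= -[_ /(congr1 size)] //=; rewrite size_rcons.
  rewrite kE in uE; exists u; last by rewrite uE.
  rewrite mem_words -(accepts_build wf_nil live0 lu) uE /=.
  rewrite -uniquely_sorted_greedy // usw andbT.
  have := congr1 weight uE; rewrite weight_step weight_build sw add0n.
  by move=> [->].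
have [su lu] := legalP _ uW.
have := uW; rewrite mem_words su eqxx /= -(accepts_build wf_nil live0 lu) => acc.
have ws := wf_step Close (built u).
have pw : perm_eq (step (build ([::], [::]) u) Close).1 (iota 1 n.+1).
  have := wf_perm ws; rewrite weight_step weight_build su add0n.
  by rewrite [(step _ Close).2]/= cats0.
have /andP[isw w0] := pos _ _ pw.
rewrite mem_U pw uniquely_sorted_greedy // acc /=.
apply/andP; split; first by apply/avoids_231P; apply: wf_231 ws.
by apply/avoids_4132P; apply: wf_4132 ws.
Qed.

(** Each letter lowers [l] by at most one, and [l] has to reach 0. *)
Lemma words_short n l g : n < l -> words n l g = [::].
Proof.
elim: n l g => [|n IH] l g lt_nl /=; first by case: l lt_nl.
rewrite !IH; try lia.
by do 2![case: ifP => _].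
Qed.

(** * Counting the accepted words *)

Import Order.TTheory GRing.Theory Num.Theory.
Local Open Scope ring_scope.

Lemma catalan_gf0 : catalan_gf 0%N = 1.
Proof. by rewrite catalan_gfE. Qed.

(** Compares the coefficients of x^(n+2) in (1 - 2 x C)^2 = 1 - 4 x. *)
Lemma catalan_gfS n : catalan_gf n.+1 = fps_mul catalan_gf catalan_gf n.
Proof.
pose s := fps_sqrt (fps_sub fps_one (fps_scale 4 fps_X)).
have sE m : s m.+1 = - 2 * catalan_gf m.
  by rewrite /catalan_gf -/s /fps_scale /fps_divX /fps_sub /fps_one /=; field.
have s0 : s 0%N = 1 by rewrite /s fps_sqrt_1B4X /fps_binomial big_ord0 expr0 fact0.
have := fps_sqrt_1B4X_square n.+2.
rewrite -/s /fps_mul big_ord_recl big_ord_recr /= subn0 /bump /= subnn s0.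
under eq_bigr => i _ do rewrite add1n subSS subSn -1?ltnS // !sE.
rewrite add1n sE.
rewrite /fps_sub /fps_one /fps_scale /fps_X /= => h.
have -> : \sum_(i < n.+1) catalan_gf i * catalan_gf (n - i)%N =
  1 / 4 * \sum_(i < n.+1) (-2 * catalan_gf i) * (-2 * catalan_gf (n - i)%N).
  by rewrite mulr_sumr; apply: eq_bigr => i _; field.
move: h; set S := \sum_(i < _) _; lra.
Qed.

(** * Power series truncated modulo X^N *)

Section Truncation.
Variable N : nat.

(** Polynomials make [ring] available; the functional equations then hold up to an explicit multiple
    of X^N. *)
Definition catalan_poly : {poly rat} := \poly_(i < N) catalan_gf i.

Local Notation C := catalan_poly.

Lemma catalan_poly_eq :
  exists E, C - 1 - 'X * C ^+ 2 = E * 'X^N.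
Proof.
exists (drop_poly N (C - 1 - 'X * C ^+ 2)).
rewrite -[LHS](poly_take_drop N) -[RHS]add0r; congr (_ + _).
apply/polyP => i; rewrite coef_take_poly coef0; case: ltnP => // lt_iN.
rewrite !coefB coef_poly lt_iN coef1 coefXM.
case: i lt_iN => [|i] lt_iN; first by rewrite catalan_gf0 /= subrr.
rewrite /= subr0 catalan_gfS expr2 coefM -sumrB big1 // => j _.
by have lt_ji := ltn_ord j; rewrite !coef_poly !ifT ?subrr //; lia.
Qed.

Definition tree_poly : {poly rat} := C \Po ('X * C).
Local Notation F := tree_poly.

(** Substitutes X C for X in the equation of C; the error becomes a multiple of (X C)^N, hence of
    X^N. *)
Lemma tree_poly_eq : exists E, F - 1 - 'X * C * F ^+ 2 = E * 'X^N.
Proof.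
have [E CE] := catalan_poly_eq.
exists ((E \Po ('X * C)) * C ^+ N).
have := congr1 (comp_poly ('X * C)) CE.
rewrite expr2 !rmorphB rmorph1 !rmorphM /= comp_polyX comp_Xn_poly -/tree_poly.
rewrite -expr2 => ->.
by rewrite exprMn; ring.
Qed.

Lemma coef_X_catalan n : (n < N)%N -> fps_mul fps_X catalan_gf n = ('X * C)`_n.
Proof.
move=> lt_nN; rewrite coefXM /fps_mul /fps_X; case: n lt_nN => [|n] lt_nN.
  by rewrite big_ord1 mul0r.
rewrite !big_ord_recl mul0r add0r mul1r big1 => [|i _]; last by rewrite mul0r.
by rewrite addr0 /= coef_poly ltnW // subSS subn0.
Qed.

Lemma coef_X_catalan_exp k n : (n < N)%N ->
  fps_exp (fps_mul fps_X catalan_gf) k n = (('X * C) ^+ k)`_n.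
Proof.
elim: k n => [|k IH] n lt_nN; first by rewrite expr0 coef1.
rewrite /fps_exp iterS -/(fps_exp _ k) exprS coefM /fps_mul.
apply: eq_bigr => i _; have lt_in := ltn_ord i.
by rewrite -/(fps_mul _ _ _) coef_X_catalan ?IH //; lia.
Qed.

End Truncation.

Lemma coef_tree_poly n :
  fps_comp catalan_gf (fps_mul fps_X catalan_gf) n = (tree_poly n.+1)`_n.
Proof.
rewrite /tree_poly [X in X \Po _]poly_def linear_sum coef_sum.
apply: eq_bigr => i _.
by rewrite /= comp_polyZ comp_Xn_poly coefZ (@coef_X_catalan_exp n.+1).
Qed.

(** * Generating polynomials of the accepted words *)

Section Counting.
Variable N : nat.
Local Notation C := (catalan_poly N).
Local Notation F := (tree_poly N).

(** Solves F a_g = X F^2 a_(g+1) + a_(g-1) + 1 modulo X^N, with a_0 = 0 and a_1 = C. Since 1 - X C F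
    is the inverse of F there, the multiplier is C / F, the power series root of X F^2 z^2 - F z + 1
    = 0. *)
Definition open_poly (g : nat) : {poly rat} :=
  iter g (fun p => C + C * (1 - 'X * C * F) * p) 0.

(** The value 0 of [open_poly] at 0 encodes the missing [Back] term at g = 1, so the true factor 1
    at g = 0 is supplied separately. *)
Definition words_poly (l g : nat) : {poly rat} :=
  F ^+ l.+1 * (if g == 0%N then 1 else open_poly g).

Lemma words_poly_eq l g : exists E,
  words_poly l g = 'X * words_poly l.+1 g.+1 +
    (if (1 < g)%N then F ^+ l * open_poly g.-1 else 0) + F ^+ l + E * 'X^N.
Proof.
have [EC hC] := catalan_poly_eq N; have [EF hF] := tree_poly_eq N.
case: g => [|g].
  exists (F ^+ l * EF); rewrite -mulrA -hF /words_poly /= !exprS /open_poly /=.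
  by ring.
set p := open_poly g.
have -> : (if (1 < g.+1)%N then F ^+ l * open_poly g else 0) = F ^+ l * p.
  by rewrite /p; case: g {p} => [|g]; rewrite /= /open_poly /= ?mulr0.
set q := C + C * (1 - 'X * C * F) * p.
have -> : words_poly l g.+1 = F ^+ l.+1 * q by [].
have -> : words_poly l.+1 g.+2 = F ^+ l.+2 * (C + C * (1 - 'X * C * F) * q) by [].
(* The difference of the two sides is a combination of the defining relations of F and C; the
   factors of [EF] and [EC] are its cofactors. *)
exists (F ^+ l * (EF * (C * p + 1 - (C - 1) * p - 'X * C * F * q)
                  + EC * (F + p + EF * 'X^N * p))).
rewrite -hF -[RHS]addrA.
have -> : F ^+ l * (EF * (C * p + 1 - (C - 1) * p - 'X * C * F * q)
   + EC * (F + p + (F - 1 - 'X * C * F ^+ 2) * p)) * 'X^N =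
  F ^+ l * ((EF * 'X^N) * (C * p + 1 - (C - 1) * p - 'X * C * F * q)
   + (EC * 'X^N) * (F + p + (F - 1 - 'X * C * F ^+ 2) * p)) by ring.
rewrite -hF -hC /q !exprS expr0; ring.
Qed.

(** [Front] raises [l] and uses one letter, so it lowers [j] by one and carries the factor X; [Back]
    and [Close] lower [l] and keep [j]. *)
Lemma size_words n l g j : (n = l + j.*2)%N -> (g <= l)%N -> (j < N)%N ->
  (size (words n l g))%:R = (words_poly l g)`_j.
Proof.
elim: n l g j => [|n IH] l g j nE le_gl lt_jN;
    have [E ->] := words_poly_eq l g; rewrite !coefD coefXM coefMXn lt_jN addr0.
  have [l0 j0] : l = 0%N /\ j = 0%N by lia.
  have g0 : g = 0%N by lia.
  by rewrite l0 j0 g0 /= coef0 !add0r expr0 coef1.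
rewrite /= !size_cat size_map !natrD addrA; congr (_ + _ + _).
- case: j nE lt_jN => [|j] nE lt_jN; first by rewrite words_short //; lia.
  by apply: IH; lia.
- case: ltnP => [g1|_]; last by rewrite coef0.
  rewrite size_map (IH _ _ j) /words_poly; try lia.
  by rewrite prednK ?ifF //; lia.
(* The term F^l stands for [Close]. At l = 0 it is the constant 1, which counts the empty word and
   contributes nothing when j > 0. *)
case: posnP => [l0|l0] /=.
  by rewrite l0 expr0 coef1; case: j nE {lt_jN} => //; rewrite l0.
rewrite size_map (IH _ _ j) /words_poly; try lia.
by rewrite prednK // mulr1.
Qed.

End Counting.

Theorem theorem8p1 :
  (fun k : nat => (size (U (2 * k + 1) [:: 2; 3; 1] [:: 4; 1; 3; 2])%N)%:R : rat)
  =1 fps_comp catalan_gf (fps_mul fps_X catalan_gf).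
Proof.
move=> k; rewrite coef_tree_poly addn1 (perm_size (U_words _)) size_map.
(* From the empty state, l = g = 0, the generating polynomial is F itself, and truncation at k + 1
   keeps coefficient k. *)
by rewrite (@size_words k.+1 _ _ _ k) ?mul2n // /words_poly expr1 mulr1.
Qed.
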